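(* Let $C=1+\dfrac{\pi^2-4}{\pi^2+4}$. Let $G$ be a finite simple graph with $m$ edges that is not a complete graph, let $\lambda_1\ge\lambda_2\ge\dots\ge\lambda_n$ be the eigenvalues of its adjacency matrix, and let $\omega(G)$ be its clique number. Then $$\lambda_1^2+\lambda_2^2\ \le\ \left(1-\frac{1}{C\,\omega(G)}\right)2m .$$
   Context: Graphs are finite and simple with at least one vertex; eigenvalues are listed with multiplicity. The clique number is the maximum number of pairwise adjacent vertices. *)

(* Defs.v *)
From HB Require Import structures.
From mathcomp Require Import all_boot all_order all_algebra.
From mathcomp Require Import all_reals.
From mathcomp Require Import trigo.

Set Implicit Arguments.
Unset Strict Implicit.
Unset Printing Implicit Defensive.
Import Order.TTheory GRing.Theory Num.Theory.
Local Open Scope ring_scope.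

(* MathComp world. A finite simple graph is a symmetric irreflexive relation
   e on a finite vertex type T. *)

Section Graph.
Variables (T : finType) (e : rel T).

Definition edge_set : {set {set T}} :=
  [set E : {set T} | [exists x, exists y, e x y && (E == [set x; y])]].

Definition is_complete : Prop := forall x y : T, x != y -> e x y.

Definition is_clique (A : {set T}) : bool :=
  [forall x in A, forall y in A, (x != y) ==> e x y].

Definition clique_number : nat := (\max_(A : {set T} | is_clique A) #|A|)%N.

(* Vertices are indexed through the enumeration of T; the spectrum does not
   depend on that enumeration. *)
Definition adjacency (R : pzSemiRingType) : 'M[R]_#|T| :=
  \matrix_(i, j) (e (enum_val i) (enum_val j))%:R.

End Graph.

(* s lists all eigenvalues of A, with (algebraic) multiplicity, in
   nonincreasing order; in particular size s = n. *)
Definition is_spectrum (R : realFieldType) (n : nat) (A : 'M[R]_n)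
    (s : seq R) : Prop :=
  sorted >=%R s /\ char_poly A = \prod_(a <- s) ('X - a%:P).

Definition constC (R : realType) : R := 1 + (pi ^+ 2 - 4) / (pi ^+ 2 + 4).

(* Main.v *)
Require Import Defs.
From HB Require Import structures.
From mathcomp Require Import all_boot all_order all_algebra.
From mathcomp Require Import all_reals.
From mathcomp Require Import trigo.
From mathcomp Require Import topology normedtype derive.
From mathcomp Require Import ring lra.

(* Let A be the adjacency matrix and P = l_1 x x^T + l_2 z z^T its truncation
   to the two largest eigenvalues, so that <A, P> = |P|^2 = l_1^2 + l_2^2.
   Cauchy-Schwarz over the edges gives |P|^4 <= 2m (|P|^2 - N), where N is the
   sum of P_ij^2 over nonadjacent (or equal) i, j, and it remains to see that
   N >= 8/11 |P|^2 / omega, as 1/C = 1/2 + 2/pi^2 <= 8/11.  Since G is not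
   complete, l_2 >= 0 and P is the Gram matrix of plane vectors (u_i, v_i); in
   terms of y = u^2 + v^2, p = u^2 - v^2, q = 2uv one has
   2 P_ij^2 = y_i y_j + p_i p_j + q_i q_j.  For each of the four linear forms
   a = p, q, p + q, p - q, the Motzkin-Straus inequality applied to the
   positive and to the negative part of a bounds below the sum over
   nonadjacent pairs of a_i a_j + |a_i a_j|, and a suitable combination of
   these four kernels is at most 2 P_ij^2. *)

Set Implicit Arguments.
Unset Strict Implicit.
Unset Printing Implicit Defensive.
Import Order.TTheory GRing.Theory Num.Theory.
Local Open Scope ring_scope.

(** * The spectral theorem for real symmetric matrices *)

Lemma char_poly_conj (R : comUnitRingType) n (P Q A : 'M[R]_n) :
  P *m Q = 1%:M -> char_poly (P *m A *m Q) = char_poly A.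
Proof.
move=> PQ; rewrite /char_poly /char_poly_mx.
have Pp : map_mx polyC P *m map_mx polyC Q = 1%:M.
  by rewrite -map_mxM PQ map_mx1.
have -> : 'X%:M - map_mx polyC (P *m A *m Q) =
    map_mx polyC P *m ('X%:M - map_mx polyC A) *m map_mx polyC Q.
  by rewrite mulmxBr mulmxBl scalar_mxC -(mulmxA 'X%:M) Pp mulmx1 !map_mxM.
by rewrite !det_mulmx mulrAC -det_mulmx Pp det1 mul1r.
Qed.

Lemma row_sqnorm_ge0 (R : realFieldType) n (w : 'rV[R]_n) :
  0 <= (w *m w^T) 0 0.
Proof. by rewrite mxE sumr_ge0// => j _; rewrite mxE -expr2 sqr_ge0. Qed.

Lemma row_sqnorm_eq0 (R : realFieldType) n (w : 'rV[R]_n) :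
  ((w *m w^T) 0 0 == 0) = (w == 0).
Proof.
apply/eqP/eqP => [|->]; last by rewrite mul0mx mxE.
rewrite mxE => w0; apply/rowP => j; rewrite mxE.
have sq_ge0 (i : 'I_n) : true -> 0 <= w 0 i * w^T i 0.
  by move=> _; rewrite mxE -expr2 sqr_ge0.
have /eqP := psumr_eq0P sq_ge0 w0 (i := j) isT.
by rewrite mxE mulf_eq0 orbb => /eqP.
Qed.

(** The reflection in the hyperplane orthogonal to [a - x] swaps the two unit vectors. With [a] the
    first basis vector it yields an orthogonal matrix whose first row is [x]. *)
Lemma householder (R : realFieldType) n (a x : 'rV[R]_n) :
  a *m a^T = 1%:M -> x *m x^T = 1%:M ->
  exists2 H : 'M[R]_n, H *m H^T = 1%:M & a *m H = x.
Proof.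
move=> aa xx; have [<-|nax] := eqVneq a x.
  by exists 1%:M; rewrite ?trmx1 mulmx1.
pose w := a - x; pose N := (w *m w^T) 0 0.
have N0 : N != 0 by rewrite row_sqnorm_eq0 subr_eq0.
have Nw : w *m w^T = N%:M by rewrite [LHS]mx11_scalar.
pose c := (a *m x^T) 0 0.
have ax : a *m x^T = c%:M by rewrite [LHS]mx11_scalar.
have xa : x *m a^T = c%:M by rewrite -[LHS]trmxK trmx_mul trmxK ax tr_scalar_mx.
have NE : N = 2 * (1 - c).
  by rewrite /N /w linearB /= mulmxBr !mulmxBl aa xx ax xa !mxE /=; ring.
have aw : a *m w^T = (N / 2)%:M.
  rewrite /w linearB /= mulmxBr aa ax NE; apply/matrixP => i j.
  by rewrite !mxE !ord1 eqxx !mulr1n; field.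
pose H := 1%:M - (2 / N) *: (w^T *m w).
have HT : H^T = H.
  by rewrite /H linearB /= linearZ /= trmx_mul trmxK trmx1.
exists H.
  rewrite HT {1}/H mulmxBl mul1mx -scalemxAl.
  have -> : w^T *m w *m H = - (w^T *m w).
    rewrite /H mulmxBr mulmx1 -scalemxAr mulmxA -(mulmxA w^T) Nw.
    rewrite scalar_mxC -mulmxA mul_scalar_mx scalerA divfK//.
    by rewrite scaler_nat mulr2n opprD addNKr.
  by rewrite /H scalerN opprK subrK.
rewrite /H mulmxBr mulmx1 -scalemxAr mulmxA aw mul_scalar_mx scalerA.
have -> : 2 / N * (N / 2) = 1 by field.
by rewrite scale1r /w opprB addrC subrK.
Qed.

Lemma sym_block_row0 (R : comPzRingType) n (B : 'M[R]_(1 + n)) (l : R) :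
  B^T = B -> delta_mx 0 0 *m B = l *: (delta_mx 0 0 : 'rV_(1 + n)) ->
  B = block_mx l%:M 0 0 (drsubmx B).
Proof.
move=> BT aB.
have B0j j : B 0 j = l *+ (j == 0).
  have /matrixP/(_ 0 j) := aB; rewrite -rowE !mxE => ->.
  by rewrite eqxx /= mulr_natr.
rewrite -[LHS]submxK; congr block_mx; apply/matrixP => i j; rewrite !mxE.
- by rewrite !ord1 lshift0 B0j eqxx.
- by rewrite ord1 lshift0 B0j.
- by rewrite -BT mxE ord1 lshift0 B0j.
Qed.

Lemma char_poly_block (R : comNzRingType) n (D : 'M[R]_n) (l : R) :
  char_poly (block_mx l%:M 0 0 D : 'M_(1 + n)) = ('X - l%:P) * char_poly D.
Proof.
rewrite /char_poly /char_poly_mx map_block_mx !map_mx0.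
rewrite (@scalar_mx_block _ 1 n) opp_block_mx add_block_mx !oppr0 !addr0.
by rewrite det_lblock map_scalar_mx /= det_mx11 !mxE eqxx !mulr1n.
Qed.

(** Deflation along the head of [s]: a reflection turns a unit eigenvector into the first basis
    vector, and the remaining block has the tail of [s] as spectrum. The diagonal thus keeps the
    order of [s]. *)
Theorem spectral_real (R : rcfType) n (A : 'M[R]_n) (s : seq R) :
  A^T = A -> char_poly A = \prod_(a <- s) ('X - a%:P) ->
  exists2 U : 'M[R]_n, U *m U^T = 1%:M &
    U *m A *m U^T = diag_mx (\row_i s`_i).
Proof.
elim: n A s => [|n IHn] A s AT As.
  by exists 1%:M; apply/matrixP => -[].
have [l [t sE]] : exists l t, s = l :: t.
  case: s As => [|l t] As; last by exists l, t.
  by have := size_char_poly A; rewrite As big_nil size_poly1.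
have [v vA v0] : exists2 v : 'rV_n.+1, v *m A = l *: v & v != 0.
  apply/eigenvalueP; rewrite eigenvalue_root_char As sE big_cons.
  by rewrite rootM root_XsubC eqxx.
pose x := (Num.sqrt ((v *m v^T) 0 0))^-1 *: v.
have vv : 0 < (v *m v^T) 0 0.
  by rewrite lt_neqAle eq_sym row_sqnorm_eq0 v0 row_sqnorm_ge0.
have xx : x *m x^T = 1%:M.
  rewrite /x linearZ /= -scalemxAl -scalemxAr scalerA -invfM -expr2.
  rewrite sqr_sqrtr ?(ltW vv)//; set N := (_ 0 0) in vv *.
  rewrite [v *m _]mx11_scalar -/N scale_scalar_mx.
  by rewrite mulVf// gt_eqF.
have xA : x *m A = l *: x by rewrite /x -scalemxAl vA !scalerA mulrC.
pose a : 'rV[R]_n.+1 := delta_mx 0 0.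
have aa : a *m a^T = 1%:M.
  rewrite /a trmx_delta mul_delta_mx; apply/matrixP => i j.
  by rewrite !mxE !ord1 eqxx.
have [H HH aH] := householder aa xx.
pose B : 'M[R]_(1 + n) := H *m A *m H^T.
have BT : B^T = B by rewrite /B !trmx_mul trmxK AT mulmxA.
have aB : a *m B = l *: a.
  by rewrite /B !mulmxA aH xA -scalemxAl -aH -mulmxA HH mulmx1.
have BE := sym_block_row0 BT aB.
have [|| V VV VB] := IHn (drsubmx B) t.
- by rewrite trmx_drsub BT.
- have : char_poly B = char_poly A by exact: char_poly_conj.
  rewrite [in LHS]BE char_poly_block As sE big_cons.
  by apply: mulfI; rewrite polyXsubC_eq0.
pose W : 'M[R]_(1 + n) := block_mx 1%:M 0 0 V.
have WT : W^T = block_mx 1%:M 0 0 V^T by rewrite tr_block_mx !trmx0 trmx1.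
have WW : W *m W^T = 1%:M.
  rewrite WT /W mulmx_block !mulmx0 !mul0mx !addr0 !add0r mulmx1 VV.
  by rewrite -scalar_mx_block.
have WB : W *m B *m W^T = block_mx l%:M 0 0 (diag_mx (\row_i t`_i)).
  rewrite BE WT /W !mulmx_block !mulmx0 !mul0mx !addr0 !add0r !mul0mx.
  by rewrite !mul1mx mulmx1 VB.
exists (W *m (H : 'M_(1 + n))).
  by rewrite trmx_mul mulmxA -(mulmxA W) HH mulmx1; exact: WW.
have -> : W *m (H : 'M_(1 + n)) *m A *m (W *m (H : 'M_(1 + n)))^T =
    W *m B *m W^T.
  by rewrite trmx_mul /B !mulmxA.
have lt : row_mx l%:M (\row_i t`_i) = \row_(i < 1 + n) (l :: t)`_i.
  apply/rowP => i; rewrite [RHS]mxE; case: (split_ordP i) => {}i ->.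
    by rewrite row_mxEl !ord1 !mxE.
  by rewrite row_mxEr mxE.
have dl : diag_mx (l%:M : 'rV_1) = l%:M.
  by apply/matrixP => i j; rewrite !mxE !ord1.
by rewrite WB sE -[RHS](congr1 (@diag_mx _ _) lt) diag_mx_row dl.
Qed.

(** * The Motzkin-Straus inequality *)

(** Lagrange's identity: the double sum of (a_i b_j - a_j b_i)^2 is twice the difference of the two
    sides. *)
Lemma sum_cauchy_schwarz (R : realFieldType) (I : finType) (P : pred I)
    (a b : I -> R) :
  (\sum_(i | P i) a i * b i) ^+ 2 <=
  (\sum_(i | P i) a i ^+ 2) * (\sum_(i | P i) b i ^+ 2).
Proof.
have : 0 <= \sum_(i | P i) \sum_(j | P j) (a i * b j - a j * b i) ^+ 2.
  by apply: sumr_ge0 => i _; apply: sumr_ge0 => j _; apply: sqr_ge0.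
under eq_bigr => i _.
  under eq_bigr => j _.
    rewrite (_ : _ ^+ 2 = a i ^+ 2 * b j ^+ 2 +
      (b i ^+ 2 * a j ^+ 2 - 2 * (a i * b i * (a j * b j)))); last by ring.
  over.
  rewrite !big_split /= sumrN -!mulr_sumr; over.
rewrite !big_split /= sumrN -mulr_sumr -!mulr_suml.
set X := \sum_(i | P i) a i ^+ 2; set Y := \sum_(i | P i) b i ^+ 2.
set Z := \sum_(i | P i) _; nra.
Qed.

Lemma sum_delta (R : pzSemiRingType) (T : finType) (g : T -> R) i :
  \sum_k (k == i)%:R * g k = g i.
Proof.
rewrite (bigD1 i)//= eqxx mul1r big1 ?addr0// => k /negPf ->.
by rewrite mul0r.
Qed.

Section MotzkinStraus.
Variables (R : realFieldType) (T : finType) (e : rel T).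
Hypotheses (e_sym : symmetric e) (e_irr : irreflexive e).

(** As [e] is irreflexive, this is J - A, with ones on the diagonal. *)
Let N i j : R := (~~ e i j)%:R.

(* No quadratic term in t: N i i + N j j = 2 * N i j. *)
Lemma nonedge_form_shift (f : T -> R) i j t : ~~ e i j ->
  let f' k := f k + t * ((k == i)%:R - (k == j)%:R) in
  \sum_k f' k * (\sum_l N k l * f' l) =
  \sum_k f k * (\sum_l N k l * f l) +
  2 * t * (\sum_l N i l * f l - \sum_l N j l * f l).
Proof.
move=> nij f'; pose h k := \sum_l N k l * f l.
have NE k l : N k l = N l k by rewrite /N e_sym.
have hE k : \sum_l N k l * f' l = h k + t * (N k i - N k j).
  under eq_bigr => l _.
    rewrite (_ : _ * _ = N k l * f l +
      t * ((l == i)%:R * N k l - (l == j)%:R * N k l));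
      last by rewrite /f'; ring.
  over.
  by rewrite big_split /= -mulr_sumr sumrB !sum_delta.
under eq_bigr => k _.
  rewrite hE (_ : _ * _ = f k * h k + t * (N i k * f k - N j k * f k) +
    t * ((k == i)%:R * h k - (k == j)%:R * h k) +
    t ^+ 2 * ((k == i)%:R * (N k i - N k j) - (k == j)%:R * (N k i - N k j)));
    last by rewrite /f' -!(NE k); ring.
over.
rewrite !big_split /= -!mulr_sumr !sumrB !sum_delta -!/(h _).
have N1 : N i j = 1 by rewrite /N nij.
have N2 k : N k k = 1 by rewrite /N e_irr.
by rewrite (NE j i) N1 !N2; ring.
Qed.

(** Cauchy-Schwarz against 1 on the support brings in the size of that clique, and the diagonal of
    [N] alone already contributes the sum of the f_i^2. *)
Lemma nonedge_form_clique (f : T -> R) : (forall i, 0 <= f i) ->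
  is_clique e [set i | f i != 0] ->
  (\sum_i f i) ^+ 2 <=
    (clique_number e)%:R * \sum_i f i * (\sum_j N i j * f j).
Proof.
move=> f0 cl; set A := [set i | _] in cl.
have -> : \sum_i f i = \sum_(i in A) 1 * f i.
  rewrite [RHS]big_mkcond; apply: eq_bigr => i _; rewrite inE mul1r.
  by case: eqP.
apply: le_trans (sum_cauchy_schwarz _ _ _) _.
apply: ler_pM.
- by rewrite sumr_ge0// => i _; rewrite expr1n.
- by rewrite sumr_ge0// => i _; rewrite sqr_ge0.
- under eq_bigr do rewrite expr1n.
  rewrite sumr_const ler_nat.
  exact: (@leq_bigmax_cond _ (is_clique e) (fun B : {set T} => #|B|)).
rewrite [leLHS]big_mkcond; apply: ler_sum => i _.
rewrite (bigD1 i)//= {1}/N e_irr mul1r mulrDr expr2.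
have : 0 <= f i * \sum_(j | j != i) N i j * f j.
  by rewrite mulr_ge0// sumr_ge0// => j _; rewrite mulr_ge0.
by case: ifP => _; have := mulr_ge0 (f0 i) (f0 i); lra.
Qed.

(** Induction on the size of the support: while it contains a nonadjacent pair, moving the whole
    weight of one vertex to the other keeps the sum and shrinks the support. *)
Theorem motzkin_straus (f : T -> R) : (forall i, 0 <= f i) ->
  (\sum_i f i) ^+ 2 <=
    (clique_number e)%:R * \sum_i f i * (\sum_j N i j * f j).
Proof.
have [n] := ubnP #|[set i | f i != 0]|.
elim: n f => // n IHn f; rewrite ltnS => fn f0.
have [|] := boolP (is_clique e [set i | f i != 0]).
  exact: nonedge_form_clique.
move=> /forall_inPn[i0 fi0 /forall_inPn[j0]]; rewrite negb_imply.
move=> fj0 /andP[ij0 nij0].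
(* The form is affine along the shift, so one of the two directions does not increase it. *)
wlog hij : i0 j0 fi0 fj0 ij0 nij0 /
    \sum_l N i0 l * f l <= \sum_l N j0 l * f l => [hw|].
  have [/hw|/ltW/hw] := leP (\sum_l N i0 l * f l) (\sum_l N j0 l * f l).
    exact.
  by apply; rewrite // 1?eq_sym// e_sym.
rewrite !inE in fi0 fj0.
have := nonedge_form_shift f (f j0) nij0.
set f' := fun k => _ => /= f'E.
have f'0 k : 0 <= f' k.
  rewrite /f'; have [->|ki] := eqVneq k i0.
    by rewrite (negPf ij0) subr0 mulr1 addr_ge0.
  have [->|kj] := eqVneq k j0; first by rewrite sub0r mulrN1 subrr.
  by rewrite subrr mulr0 addr0.
have sE : \sum_k f' k = \sum_k f k.
  have s1 (i : T) : \sum_k (k == i)%:R = 1 :> R.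
    rewrite -[RHS](sum_delta (fun=> 1) i).
    by apply: eq_bigr => k _; rewrite mulr1.
  by rewrite /f' big_split /= -mulr_sumr sumrB !s1 subrr mulr0 addr0.
rewrite -sE; apply: le_trans (IHn f' _ f'0) _.
  apply: leq_trans fn; apply: proper_card; apply/properP; split.
    apply/subsetP => k; rewrite !inE /f'.
    have [->//|ki] := eqVneq k i0.
    by have [->//|kj] := eqVneq k j0; rewrite subrr mulr0 addr0.
  exists j0; rewrite ?inE// /f' eqxx (eq_sym j0) (negPf ij0) sub0r mulrN1.
  by rewrite subrr eqxx.
rewrite f'E ler_wpM2l// gerDl mulr_ge0_le0 ?subr_le0//.
by rewrite mulr_ge0.
Qed.

(** Apply the inequality to |a| + a and |a| - a, twice the positive and negative parts; the mixed
    terms cancel in the sum. *)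
Lemma motzkin_straus_signed (a : T -> R) :
  (\sum_i a i) ^+ 2 + (\sum_i `|a i|) ^+ 2 <=
  (clique_number e)%:R *
    \sum_i \sum_j N i j * (a i * a j + `|a i * a j|).
Proof.
have a1 i : 0 <= `|a i| + a i by have := ler_norm (- a i); rewrite normrN; lra.
have a2 i : 0 <= `|a i| - a i by have := ler_norm (a i); lra.
have := lerD (motzkin_straus a1) (motzkin_straus a2).
rewrite -mulrDr -big_split /=.
have -> : \sum_i ((`|a i| + a i) * (\sum_j N i j * (`|a j| + a j)) +
    (`|a i| - a i) * (\sum_j N i j * (`|a j| - a j))) =
  2 * \sum_i \sum_j N i j * (a i * a j + `|a i * a j|).
  rewrite mulr_sumr; apply: eq_bigr => i _; rewrite !mulr_sumr -big_split /=.
  by apply: eq_bigr => j _; rewrite normrM; ring.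
rewrite big_split sumrB /=; nra.
Qed.

End MotzkinStraus.

(** * Nonadjacent pairs of plane vectors *)

(** Cauchy-Schwarz for the plane vectors (|p|, |q|) and (|p'|, |q'|). *)
Lemma norm_mulD_le (R : realFieldType) (p q p' q' z : R) :
  0 <= z -> (p ^+ 2 + q ^+ 2) * (p' ^+ 2 + q' ^+ 2) = z ^+ 2 ->
  `|p * p'| + `|q * q'| <= z.
Proof.
move=> z0 E; rewrite -(ler_pXn2r (n := 2)) ?nnegrE ?addr_ge0//.
rewrite -E -(real_normK (num_real p)) -(real_normK (num_real q)).
rewrite -(real_normK (num_real p')) -(real_normK (num_real q')) !normrM.
have := sqr_ge0 (`|p| * `|q'| - `|q| * `|p'|); nra.
Qed.

(* 7/10 is a rational stand-in for 1/sqrt 2, with which 12/5 would become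
   1 + sqrt 2. *)
Lemma directions_lower_bound (R : realFieldType) (p q y : R) :
  0 <= y -> p ^+ 2 + q ^+ 2 = y ^+ 2 ->
  12 / 5 * y <= `|p| + `|q| + 7 / 10 * (`|p + q| + `|p - q|).
Proof.
(* Here a and b are the larger and smaller of |p|, |q|, and |p + q| + |p - q| >= 2a. Squaring
   reduces the claim to 120 ab >= 119 b^2. *)
have bound (a b : R) : 0 <= b -> b <= a -> 0 <= y -> a ^+ 2 + b ^+ 2 = y ^+ 2 ->
    12 / 5 * y <= a + b + 7 / 5 * a.
  move=> b0 ba y0 E; rewrite -(ler_pXn2r (n := 2)) ?nnegrE//; try lra.
  rewrite exprMn -E; have := mulr_ge0 b0 (_ : 0 <= a - b); nra.
move=> y0; rewrite -(real_normK (num_real p)) -(real_normK (num_real q)) => E.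
have [qp|/ltW pq] := leP `|q| `|p|.
  have := bound _ _ (normr_ge0 q) qp y0 E.
  have := ler_normD (p + q) (p - q).
  have -> : p + q + (p - q) = 2 * p by ring.
  rewrite normrM normr_nat; lra.
have := bound _ _ (normr_ge0 p) pq y0 (etrans (addrC _ _) E).
have := ler_normB (p + q) (p - q).
have -> : p + q - (p - q) = 2 * q by ring.
rewrite normrM normr_nat; lra.
Qed.

Theorem planar_nonedge_form (R : realFieldType) (T : finType) (e : rel T)
    (e_sym : symmetric e) (e_irr : irreflexive e) (u v : T -> R) :
  8 / 11 * \sum_i \sum_j (u i * u j + v i * v j) ^+ 2 <=
  (clique_number e)%:R *
    \sum_i \sum_j (~~ e i j)%:R * (u i * u j + v i * v j) ^+ 2.
Proof.
(* Angle doubling: if (u, v) has squared length y and angle t, then (p, q) = y (cos 2t, sin 2t),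
   which makes the squared inner product bilinear in (y, p, q). *)
pose y i := u i ^+ 2 + v i ^+ 2.
pose p i := u i ^+ 2 - v i ^+ 2.
pose q i := 2 * (u i * v i).
have y0 i : 0 <= y i by rewrite addr_ge0 ?sqr_ge0.
have pqy i : p i ^+ 2 + q i ^+ 2 = y i ^+ 2 by rewrite /p /q /y; ring.
pose K (a : T -> R) i j := a i * a j + `|a i * a j|.
have sqE i j : 2 * (u i * u j + v i * v j) ^+ 2 =
    y i * y j + p i * p j + q i * q j.
  by rewrite /y /p /q; ring.
(* Cauchy-Schwarz in the orthonormal frames (p, q) and
   (p + q, p - q) / sqrt 2. *)
have Kle i j :
    (K p i j + K q i j) / 2 + (K (p \+ q) i j + K (p \- q) i j) / 4 <=
    2 * (u i * u j + v i * v j) ^+ 2.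
  have h1 : `|p i * p j| + `|q i * q j| <= y i * y j.
    by apply: norm_mulD_le; rewrite ?mulr_ge0// !pqy exprMn.
  have h2 : `|(p i + q i) * (p j + q j)| + `|(p i - q i) * (p j - q j)| <=
      2 * (y i * y j).
    have rs k : (p k + q k) ^+ 2 + (p k - q k) ^+ 2 = 2 * y k ^+ 2.
      by rewrite -pqy; ring.
    by apply: norm_mulD_le; rewrite ?mulr_ge0// !rs; ring.
  rewrite sqE /K /=; lra.
pose Q (a : T -> R) := \sum_i \sum_j (~~ e i j)%:R * K a i j.
have QE : (Q p + Q q) / 2 + (Q (p \+ q) + Q (p \- q)) / 4 <=
    2 * \sum_i \sum_j (~~ e i j)%:R * (u i * u j + v i * v j) ^+ 2.
  rewrite /Q -!big_split /= !mulr_suml -big_split mulr_sumr /=.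
  apply: ler_sum => i _.
  rewrite -!big_split /= !mulr_suml -big_split mulr_sumr /=.
  apply: ler_sum => j _; rewrite mulrCA.
  apply: le_trans (ler_wpM2l _ (Kle i j)) => //.
  by rewrite le_eqVlt; apply/orP; left; apply/eqP; field.
have TE : 2 * \sum_i \sum_j (u i * u j + v i * v j) ^+ 2 =
    (\sum_i y i) ^+ 2 + (\sum_i p i) ^+ 2 + (\sum_i q i) ^+ 2.
  rewrite !expr2 !big_distrlr /= -!big_split mulr_sumr /=.
  apply: eq_bigr => i _; rewrite -!big_split mulr_sumr /=.
  by apply: eq_bigr => j _; rewrite -sqE.
have wQ a : (\sum_i a i) ^+ 2 + (\sum_i `|a i|) ^+ 2 <=
    (clique_number e)%:R * Q a by exact: motzkin_straus_signed.
have D : 12 / 5 * \sum_i y i <= \sum_i `|p i| + \sum_i `|q i| +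
    7 / 10 * (\sum_i `|(p \+ q) i| + \sum_i `|(p \- q) i|).
  rewrite -!big_split !mulr_sumr -big_split /=; apply: ler_sum => i _.
  exact: directions_lower_bound.
have Y0 : 0 <= \sum_i y i by rewrite sumr_ge0.
(* Cauchy-Schwarz with weights 1/2, 1/2, 1/4, 1/4 costs the factor 2 + 2 + 49/25 + 49/25 = 198/25,
   and (12/5)^2 / (198/25) = 8/11. *)
have abs_bound : 8 / 11 * (\sum_i y i) ^+ 2 <=
    ((\sum_i `|p i|) ^+ 2 + (\sum_i `|q i|) ^+ 2) / 2 +
    ((\sum_i `|(p \+ q) i|) ^+ 2 + (\sum_i `|(p \- q) i|) ^+ 2) / 4.
  move: (\sum_i y i) Y0 (\sum_i `|p i|) (\sum_i `|q i|)
    (\sum_i `|(p \+ q) i|) (\sum_i `|(p \- q) i|) D => Y Y0 a b c d D.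
  have : (12 / 5 * Y) ^+ 2 <= (a + b + 7 / 10 * (c + d)) ^+ 2.
    by rewrite ler_pXn2r ?nnegrE//; lra.
  have := sqr_ge0 (a - b); have := sqr_ge0 (c - d).
  have := sqr_ge0 (7 / 10 * (a + b) - (c + d) / 2); nra.
have := ler_wpM2l (ler0n R (clique_number e)) QE.
have := wQ p; have := wQ q; have := wQ (p \+ q); have := wQ (p \- q).
have -> : \sum_i (p \- q) i = \sum_i p i - \sum_i q i by rewrite -sumrB.
have -> : \sum_i (p \+ q) i = \sum_i p i + \sum_i q i by rewrite -big_split.
move=> hm hp hq hr hw.
(* With these weights the signed squares add up to P^2 + S^2, more than the share 8/11 that [TE]
   asks for. *)
have arith (w P S Y a b c d X Z QA QB QC QD : R) :
    8 / 11 * Y ^+ 2 <= (a ^+ 2 + b ^+ 2) / 2 + (c ^+ 2 + d ^+ 2) / 4 ->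
    2 * X = Y ^+ 2 + P ^+ 2 + S ^+ 2 ->
    (P - S) ^+ 2 + d ^+ 2 <= w * QD -> (P + S) ^+ 2 + c ^+ 2 <= w * QC ->
    S ^+ 2 + b ^+ 2 <= w * QB -> P ^+ 2 + a ^+ 2 <= w * QA ->
    w * ((QA + QB) / 2 + (QC + QD) / 4) <= w * (2 * Z) -> 8 / 11 * X <= w * Z.
  by have := sqr_ge0 P; have := sqr_ge0 S; lra.
exact: arith abs_bound TE hm hp hq hr hw.
Qed.

(** * The bound 3 <= pi *)

Section PiLowerBound.
Import numFieldNormedType.Exports.

Lemma sin_le_id (R : realType) (x : R) : 0 <= x -> sin x <= x.
Proof.
move=> x0; have [] := @MVT_segment R (@sin R) (@cos R) 0 x x0.
- by apply: continuous_subspaceT => y; apply: continuous_sin.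
move=> c _; rewrite sin0 !subr0 => ->.
by rewrite ler_piMl// cos_le1.
Qed.

(** By the triple angle formula s = sin (pi / 6) is a root of 4s^3 - 3s + 1 = (s + 1)(2s - 1)^2, so
    s = 1/2, and sin x <= x at pi / 6 concludes. *)
Lemma pi_ge3 (R : realType) : 3 <= pi :> R.
Proof.
pose x : R := pi / 6.
have p0 := pi_gt0 R.
have x0 : 0 <= x by rewrite /x; lra.
have s0 : 0 <= sin x by apply: sin_ge0_pi; rewrite /x; lra.
have : sin (x + (x + x)) = 1.
  by rewrite (_ : x + _ = pi / 2) ?sin_pihalf// /x; field.
rewrite sinD sinD cosD => s3.
have s2 := cos2Dsin2 x.
have := sin_le_id x0; rewrite {2}/x.
set s := sin x in s0 s3 s2 *; set c := cos x in s3 s2.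
have : (s + 1) * (2 * s - 1) ^+ 2 = 0.
  have c2 : c ^+ 2 = 1 - s ^+ 2 by rewrite -s2; ring.
  transitivity (1 - (3 * s * c ^+ 2 - s ^+ 3)); first by rewrite c2; ring.
  lra.
move/eqP; rewrite mulf_eq0 sqrf_eq0 => /orP[] /eqP; lra.
Qed.

End PiLowerBound.

(** * Edge counting and the inequality for Gram matrices *)

(** The fibre of (a, b) -> {a, b} over an edge {x, y} lies in {(x, y), (y, x)}. *)
Lemma sum_edges_le (R : realFieldType) (T : finType) (e : rel T) :
  \sum_i \sum_j (e i j)%:R <= 2 * #|edge_set e|%:R :> R.
Proof.
rewrite pair_bigA /= -natr_sum -natrM ler_nat.
have -> : (\sum_(p : T * T) e p.1 p.2 = \sum_(p : T * T | e p.1 p.2) 1)%N.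
  by rewrite [RHS]big_mkcond; apply: eq_bigr => p _; case: (e _ _).
rewrite (partition_big (fun p : T * T => [set p.1; p.2]) (mem (edge_set e))) /=.
  rewrite mulnC -sum_nat_const; apply: leq_sum => E.
  rewrite inE => /existsP[x /existsP[y /andP[_ /eqP ->]]].
  rewrite sum1_card; apply: leq_trans (card_size [:: (x, y); (y, x)]).
  apply: subset_leq_card; apply/subsetP => -[a b]; rewrite !inE /=.
  case/andP=> _ /eqP ab.
  have := set21 a b; rewrite ab !inE.
  have := set22 a b; rewrite ab !inE.
  have := set21 x y; rewrite -ab !inE.
  have := set22 x y; rewrite -ab !inE !xpair_eqE.
  by do 4! case/orP=> /eqP->; rewrite ?eqxx ?orbT.
move=> [a b] /= eab; rewrite inE; apply/existsP; exists a.
by apply/existsP; exists b; rewrite eab eqxx.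
Qed.

Lemma clique_number_gt0 (T : finType) (e : rel T) (x : T) :
  (0 < clique_number e)%N.
Proof.
have cl : is_clique e [set x].
  apply/forall_inP => i; rewrite inE => /eqP->.
  by apply/forall_inP => j; rewrite inE => /eqP->; rewrite eqxx.
have := @leq_bigmax_cond _ (is_clique e) (fun B : {set T} => #|B|) _ cl.
by rewrite cards1.
Qed.

(** The hypothesis is <A, P> = |P|^2, all that is kept of the eigenvectors; [x] makes the clique
    number positive. *)
Theorem planar_gram_bound (R : realFieldType) (T : finType) (e : rel T)
    (e_sym : symmetric e) (e_irr : irreflexive e) (u v : T -> R) (x : T) :
  let S := \sum_i \sum_j (u i * u j + v i * v j) ^+ 2 in
  \sum_i \sum_j (e i j)%:R * (u i * u j + v i * v j) = S ->
  S <= (1 - 8 / 11 / (clique_number e)%:R) * \sum_i \sum_j (e i j)%:R.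
Proof.
move=> S eS; set w := (clique_number e)%:R; set M := \sum_i _.
have w1 : 1 <= w by rewrite ler1n (clique_number_gt0 _ x).
pose E := \sum_i \sum_j (e i j)%:R * (u i * u j + v i * v j) ^+ 2.
pose N := \sum_i \sum_j (~~ e i j)%:R * (u i * u j + v i * v j) ^+ 2.
have EN : E + N = S.
  rewrite -big_split; apply: eq_bigr => i _; rewrite -big_split /=.
  apply: eq_bigr => j _.
  by case: (e i j); rewrite /= mul1r mul0r ?addr0 ?add0r.
have SN : 8 / 11 * S <= w * N by exact: planar_nonedge_form.
have SE : S ^+ 2 <= M * E.
  rewrite -eS !pair_bigA /=.
  have eE (F : T * T -> R) : \sum_p (e p.1 p.2)%:R * F p =
      \sum_(p | e p.1 p.2) F p.
    rewrite [RHS]big_mkcond; apply: eq_bigr => p _.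
    by case: ifP; rewrite ?mul1r ?mul0r.
  have -> : M = \sum_(p : T * T | e p.1 p.2) 1 ^+ 2.
    rewrite /M pair_bigA /= -eE; apply: eq_bigr => p _.
    by rewrite expr1n mulr1.
  rewrite /E pair_bigA /= !eE.
  have := sum_cauchy_schwarz (fun p : T * T => e p.1 p.2) (fun=> 1)
    (fun p => u p.1 * u p.2 + v p.1 * v p.2).
  by under [X in X ^+ 2 <= _ -> _]eq_bigr do rewrite mul1r.
have S0 : 0 <= S by do 2!apply: sumr_ge0 => ? _; apply: sqr_ge0.
have M0 : 0 <= M by do 2!apply: sumr_ge0 => ? _.
have c0 : 0 <= 1 - 8 / 11 / w.
  rewrite subr_ge0 ler_pdivrMr; lra.
(* The main case divides by S; otherwise the right side is nonnegative. *)
have [S1|S1] := ltP 0 S; last by apply: le_trans S1 (mulr_ge0 c0 M0).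
rewrite -(ler_pM2l S1) -expr2; apply: le_trans SE _.
rewrite mulrA [leRHS]mulrC ler_wpM2l// mulrBr mulr1.
have : S * (8 / 11 / w) <= N.
  by rewrite mulrA ler_pdivrMr; lra.
lra.
Qed.

(** * Eigenvectors of the adjacency matrix and the sign of the second eigenvalue *)

(** The rows of the diagonalising matrix, carried along [enum_rank] to functions on vertices. *)
Lemma adjacency_spectral (R : rcfType) (T : finType) (e : rel T)
    (e_sym : symmetric e) (lam : seq R) :
  char_poly (adjacency e R) = \prod_(a <- lam) ('X - a%:P) ->
  exists X : 'I_#|T| -> T -> R,
  [/\ forall k l, \sum_t X k t * X l t = (k == l)%:R,
      forall s t, \sum_k X k s * X k t = (s == t)%:R,
      forall s t, \sum_(k < #|T|) lam`_k * (X k s * X k t) = (e s t)%:R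
    & forall (k : 'I_#|T|) s, \sum_t (e s t)%:R * X k t = lam`_k * X k s].
Proof.
move=> Ap; set A := adjacency e R in Ap.
have AT : A^T = A by apply/matrixP => i j; rewrite !mxE e_sym.
have [U UU UA] := spectral_real AT Ap.
have UtU : U^T *m U = 1%:M by exact: mulmx1C.
pose X k t := U k (enum_rank t).
have reT (F : 'I_#|T| -> R) : \sum_t F (enum_rank t) = \sum_i F i.
  rewrite [RHS](reindex enum_rank)//=.
  by exists enum_val => t _; rewrite ?enum_rankK ?enum_valK.
have X1 k l : \sum_t X k t * X l t = (k == l)%:R.
  rewrite (reT (fun i => U k i * U l i)).
  have /matrixP/(_ k l) := UU; rewrite !mxE => <-.
  by apply: eq_bigr => i _; rewrite mxE.
have X2 s t : \sum_k X k s * X k t = (s == t)%:R.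
  have /matrixP/(_ (enum_rank s) (enum_rank t)) := UtU.
  rewrite !mxE (inj_eq enum_rank_inj) => <-.
  by apply: eq_bigr => i _; rewrite mxE.
have X3 s t : \sum_(k < #|T|) lam`_k * (X k s * X k t) = (e s t)%:R.
  have : A = U^T *m diag_mx (\row_i lam`_i) *m U.
    by rewrite -UA !mulmxA UtU mul1mx -mulmxA UtU mulmx1.
  move=> /matrixP/(_ (enum_rank s) (enum_rank t)).
  rewrite !mxE !enum_rankK => ->; apply: eq_bigr => k _.
  by rewrite mul_mx_diag !mxE /X; ring.
exists X; split => // k s.
transitivity (\sum_l (l == k)%:R * (lam`_l * X l s)); last first.
  exact: (sum_delta (fun l : 'I__ => lam`_l * X l s)).
under eq_bigr => t _ do rewrite -X3 mulr_suml.
rewrite exchange_big /=; apply: eq_bigr => l _.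
rewrite -X1 mulr_suml; apply: eq_bigr => t _; ring.
Qed.

(* Nonadjacent x and y span a totally isotropic plane, which meets the
   hyperplane orthogonal to X k0, where the form is negative definite. *)
Lemma negative_tail_spectrum_adjacent (R : realFieldType) (T : finType)
    (e : rel T) n (l : 'I_n -> R) (X : 'I_n -> T -> R) (k0 : 'I_n) (x y : T) :
  irreflexive e ->
  (forall s t, \sum_k X k s * X k t = (s == t)%:R) ->
  (forall s t, \sum_k l k * (X k s * X k t) = (e s t)%:R) ->
  (forall k, k != k0 -> l k < 0) -> x != y -> e x y.
Proof.
move=> e_irr XX XA l_lt0 xy; apply: contraT => nexy.
(* The c_k are the eigenbasis coordinates of a e_x + b e_y, a vector orthogonal to [X k0] on which
   the form vanishes. *)
have key a b : a * X k0 x + b * X k0 y = 0 -> a = 0 /\ b = 0.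
  move=> ab0; pose c k := a * X k x + b * X k y.
  have lc : \sum_k - (l k * c k ^+ 2) = 0.
    rewrite sumrN; apply/eqP; rewrite oppr_eq0; apply/eqP.
    transitivity (a ^+ 2 * (e x x)%:R + 2 * a * b * (e x y)%:R +
        b ^+ 2 * (e y y)%:R).
      rewrite -!XA !mulr_sumr -!big_split; apply: eq_bigr => k _ /=.
      by rewrite /c; ring.
    by rewrite !e_irr (negPf nexy) !mulr0 !addr0.
  have c0 k : c k = 0.
    have [->//|kk0] := eqVneq k k0.
    have t0 i : true -> 0 <= - (l i * c i ^+ 2).
      move=> _; have [->|/l_lt0 li] := eqVneq i k0.
        by rewrite [c k0]ab0 expr0n mulr0 oppr0.
      by rewrite oppr_ge0 mulr_le0_ge0 ?sqr_ge0 ?ltW.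
    have /eqP := psumr_eq0P t0 lc (i := k) isT.
    by rewrite oppr_eq0 mulf_eq0 lt_eqF ?l_lt0//= sqrf_eq0 => /eqP.
  have : \sum_k c k ^+ 2 = a ^+ 2 + b ^+ 2.
    transitivity (a ^+ 2 * (x == x)%:R + 2 * a * b * (x == y)%:R +
        b ^+ 2 * (y == y)%:R).
      rewrite -!XX !mulr_sumr -!big_split; apply: eq_bigr => k _ /=.
      by rewrite /c; ring.
    by rewrite !eqxx (negPf xy) mulr0 addr0 !mulr1.
  rewrite big1 => [/esym/eqP|k _]; last by rewrite c0 expr0n.
  by rewrite paddr_eq0 ?sqr_ge0// !sqrf_eq0 => /andP[/eqP-> /eqP->].
(* This choice is orthogonal to [X k0], so [X k0] vanishes at x and y; then (1, 0) qualifies too and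
   1 = 0. *)
have [|X0 X1] := key (X k0 y) (- X k0 x); first by ring.
have [|/eqP] := key 1 0; last by rewrite oner_eq0.
by move/eqP: X1; rewrite oppr_eq0 => /eqP->; rewrite mulr0 mul0r addr0.
Qed.

(** * The constant C and the final assembly *)

(** With pi >= 3, 1/2 + 2/pi^2 is at most 13/18, just below 8/11. *)
Lemma constC_inv_le (R : realType) : 1 / constC R <= 8 / 11.
Proof.
have p3 := pi_ge3 R; rewrite /constC; set p := pi in p3 *.
have p2 : 9 <= p ^+ 2 by nra.
have -> : 1 + (p ^+ 2 - 4) / (p ^+ 2 + 4) = 2 * p ^+ 2 / (p ^+ 2 + 4).
  by field; rewrite gt_eqF//; lra.
rewrite div1r invf_div ler_pdivrMr; lra.
Qed.

Theorem theorem3 (R : realType) (T : finType) (e : rel T)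
    (e_sym : symmetric e) (e_irr : irreflexive e)
    (T_gt0 : (0 < #|T|)%N) (e_ncomplete : ~ is_complete e)
    (lam : seq R) (lam_spec : is_spectrum (adjacency e R) lam) :
  lam`_0 ^+ 2 + lam`_1 ^+ 2 <=
    (1 - 1 / (constC R * (clique_number e)%:R)) * (2 * #|edge_set e|%:R).
Proof.
have /existsP[x /existsP[y /andP[xy nexy]]] :
    [exists x, exists y, (x != y) && ~~ e x y].
  apply: contra_notT e_ncomplete => /existsPn h x y xy.
  by have /existsPn/(_ y) := h x; rewrite xy negbK.
(* Two vertices exist, so the entry of [lam] at index 1 is an eigenvalue and not the default 0. *)
have n1 : (1 < #|T|)%N.
  by apply/card_gt1P; exists x, y.
case: lam_spec => lam_sorted lam_char.
have size_lam : size lam = #|T|.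
  have := size_char_poly (adjacency e R).
  by rewrite lam_char size_prod_XsubC => -[].
have [X [X1 X2 X3 X4]] := adjacency_spectral e_sym lam_char.
pose k0 := Ordinal T_gt0; pose k1 := Ordinal n1.
have lam_le i j : (i <= j < #|T|)%N -> lam`_j <= lam`_i.
  move=> /andP[ij jn].
  apply: (sorted_leq_nth (rev_trans le_trans) _ 0 lam_sorted) => //.
  - by rewrite inE size_lam (leq_ltn_trans ij).
  - by rewrite inE size_lam.
(* Were it negative, all eigenvalues after the first would be, and x and y would be adjacent. *)
have l1 : 0 <= lam`_1.
  rewrite leNgt; apply: contra nexy => l1.
  apply: (negative_tail_spectrum_adjacent (k0 := k0) e_irr X2 X3) => // k kk0.
  apply: le_lt_trans l1; apply: lam_le; rewrite ltn_ord andbT lt0n.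
  by apply: contra kk0 => /eqP k_eq0; apply/eqP/val_inj.
have l0 : 0 <= lam`_0 by apply: le_trans l1 (lam_le _ _ _).
pose a := X k0; pose b := X k1.
have aa : \sum_t a t * a t = 1 by rewrite X1.
have ab : \sum_t a t * b t = 0 by rewrite X1.
have bb : \sum_t b t * b t = 1 by rewrite X1.
have Aa s : \sum_t (e s t)%:R * a t = lam`_0 * a s by rewrite X4.
have Ab s : \sum_t (e s t)%:R * b t = lam`_1 * b s by rewrite X4.
clearbody a b.
pose u t := Num.sqrt lam`_0 * a t; pose v t := Num.sqrt lam`_1 * b t.
have uvE s t : u s * u t + v s * v t =
    lam`_0 * a s * a t + lam`_1 * b s * b t.
  have sqE (c x1 x2 : R) : 0 <= c ->
      Num.sqrt c * x1 * (Num.sqrt c * x2) = c * x1 * x2.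
    by move=> c0; rewrite mulrACA -expr2 sqr_sqrtr// mulrA.
  by rewrite /u /v !sqE.
have SE : \sum_s \sum_t (u s * u t + v s * v t) ^+ 2 =
    lam`_0 ^+ 2 + lam`_1 ^+ 2.
  have sqE s t : (u s * u t + v s * v t) ^+ 2 =
      lam`_0 ^+ 2 * (a s * a s) * (a t * a t) +
      (2 * lam`_0 * lam`_1 * (a s * b s) * (a t * b t) +
       lam`_1 ^+ 2 * (b s * b s) * (b t * b t)).
    by rewrite uvE; ring.
  transitivity (\sum_s (lam`_0 ^+ 2 * (a s * a s) + lam`_1 ^+ 2 * (b s * b s))).
    apply: eq_bigr => s _; under eq_bigr => t _ do rewrite sqE.
    by rewrite !big_split /= -!mulr_sumr aa ab bb mulr0 add0r !mulr1.
  by rewrite big_split /= -!mulr_sumr aa bb !mulr1.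
have AE : \sum_s \sum_t (e s t)%:R * (u s * u t + v s * v t) =
    lam`_0 ^+ 2 + lam`_1 ^+ 2.
  have AuvE s t : (e s t)%:R * (u s * u t + v s * v t) =
      lam`_0 * a s * ((e s t)%:R * a t) + lam`_1 * b s * ((e s t)%:R * b t).
    by rewrite uvE; ring.
  transitivity (\sum_s (lam`_0 ^+ 2 * (a s * a s) + lam`_1 ^+ 2 * (b s * b s))).
    apply: eq_bigr => s _; under eq_bigr => t _ do rewrite AuvE.
    by rewrite big_split /= -!mulr_sumr Aa Ab; ring.
  by rewrite big_split /= -!mulr_sumr aa bb !mulr1.
have := planar_gram_bound e_sym e_irr x (etrans AE (esym SE)).
rewrite SE => /le_trans; apply.
have w1 : 1 <= (clique_number e)%:R :> R.
  by rewrite ler1n (clique_number_gt0 _ x).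
have w0 := lt_le_trans ltr01 w1.
(* Both factors only grow: 1/C <= 8/11, and the ordered adjacent pairs number at most 2m. *)
apply: ler_pM.
- by rewrite subr_ge0 ler_pdivrMr//; lra.
- by do 2! apply: sumr_ge0 => ? _.
- rewrite lerD2l lerN2 !div1r invfM ler_wpM2r ?invr_ge0 ?(ltW w0)//.
  by have := constC_inv_le R; rewrite div1r.
- exact: sum_edges_le.
Qed.
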